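(* Let $A$ and $B$ be nonempty closed and convex subsets of a reflexive and strictly convex Banach space $X$. Let $T:A\cup B\to A\cup B$ be a cyclic contraction map. Suppose that $X$ has property $(H)$. Then there exists a unique point $b_0\in B$ such that $\|b_0-Tb_0\|=\operatorname{dist}(A,B)$. Moreover, there exist $h\in X$ and $B_0\subseteq B$ such that, if $T'(b)=Tb+h$ for $b\in B_0$, then (i) $T':B_0\to B_0$, (ii) $b_0=Tb_0+h$, and (iii) $(T')^n(b)\to b_0$ for each $b\in B_0$.
   Context: $\operatorname{dist}(A,B)=\inf\{\|x-y\|: x\in A,\ y\in B\}$. $T:A\cup B\to A\cup B$ is a cyclic contraction if $T(A)\subseteq B$, $T(B)\subseteq A$, and there is $k\in(0,1)$ such that $\|Tx-Ty\|\le k\|x-y\|+(1-k)\operatorname{dist}(A,B)$ for all $x\in A$, $y\in B$. A Banach space $X$ has property $(H)$ if weak and norm convergence coincide for sequences on the unit sphere of $X$; that is, if $\|x_n\|=\|x\|=1$ and $x_n\rightharpoonup x$ weakly, then $x_n\to x$ in norm. *)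

(* Defs.v *)
From HB Require Import structures.
From mathcomp Require Import all_boot all_order all_algebra.
From mathcomp Require Import all_classical all_reals all_analysis.

Set Implicit Arguments.
Unset Strict Implicit.
Unset Printing Implicit Defensive.

Import Order.TTheory GRing.Theory Num.Theory.
Import numFieldNormedType.Exports.

Local Open Scope classical_set_scope.
Local Open Scope ring_scope.

Section Duality.
Context {R : realType} (X : normedModType R).

(* The dual X* as a set of functions on X. *)
Definition dual : set (X -> R^o) := [set f | linear f /\ continuous f].

Definition dual_norm (f : X -> R^o) : R :=
  sup [set `|f x| | x in [set x | `|x| <= 1]].

(* The elements of X** are the linear functionals on X* that are bounded for
   [dual_norm]; values of [phi] outside [dual] are junk. *)
Definition bidual : set ((X -> R^o) -> R) := [set phi |
  (forall (a : R) f g, dual f -> dual g ->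
     phi (fun x => a * f x + g x) = a * phi f + phi g) /\
  (exists C : R, forall f, dual f -> `|phi f| <= C * dual_norm f)].

(* Surjectivity of the canonical embedding of X into X**. *)
Definition reflexive_space :=
  forall phi, bidual phi -> exists x : X, forall f, dual f -> phi f = f x.

Definition weak_cvg (u : nat -> X) (x : X) :=
  forall f, dual f -> f (u n) @[n --> \oo] --> f x.

Definition property_H := forall (u : nat -> X) (x : X),
  (forall n, `|u n| = 1) -> `|x| = 1 -> weak_cvg u x -> u @ \oo --> x.

Definition strictly_convex_space := forall x y : X,
  `|x| = 1 -> `|y| = 1 -> x != y -> `|2^-1 *: (x + y)| < 1.

End Duality.

Section CyclicContraction.
Context {R : realType} {X : normedModType R}.

Definition dist (A B : set X) : R :=
  inf [set `|x - y| | x in A & y in B].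

(* A map on A `|` B is encoded as a function on X; only its values on
   A `|` B are constrained. *)
Definition cyclic_contraction (A B : set X) (T : X -> X) :=
  [/\ T @` A `<=` B, T @` B `<=` A &
      exists2 k : R, 0 < k < 1 &
        forall x y, A x -> B y ->
          `|T x - T y| <= k * `|x - y| + (1 - k) * dist A B].

End CyclicContraction.

(* Main.v *)
(* Write d = dist(A,B).  Weak compactness is used only through ultrafilters: if
   u is a bounded sequence, f |-> lim_U f(u_n) lies in the bidual, so
   reflexivity gives it a weak limit along U, and Hahn-Banach keeps that limit
   in every closed convex set containing the u_n.

   Applied to the even and odd parts of a T-orbit, this yields a pair in A x B at
   distance d, and by strict convexity all such pairs have the same difference
   b - a = h.  Let B_0 be the set of the b in B with b - h in A.  For b in B_0,
   T'b = Tb + h equals T(b - h), whence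
     |T'b - T'c -+ h| - d <= k (|b - c +- h| - d)   for b, c in B_0.
   So u = T'^n b - T'^m b satisfies |h + u|, |h - u| -> d = |h|.  Every weak limit
   of u then vanishes by strict convexity, and property (H) upgrades h + u -> h
   to norm convergence: the T'-orbits are Cauchy.  The same inequality shows that
   their limits are fixed points of T' and that T' has only one. *)
Require Import Defs.
From HB Require Import structures.
From mathcomp Require Import all_boot all_order all_algebra.
From mathcomp Require Import all_classical all_reals all_analysis.
From mathcomp Require Import ring lra.
Import Order.TTheory GRing.Theory Num.Theory.
Import numFieldNormedType.Exports.
Local Open Scope classical_set_scope.
Local Open Scope ring_scope.

(** * Convex and conical combinations *)

Lemma convex_set_conv {R : realType} {V : lmodType R} {A : set V} {x y : V}
    {t : R} : convex_set (A : set (convex_lmodType V)) ->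
  A x -> A y -> 0 <= t <= 1 -> A (t *: x + (1 - t) *: y).
Proof.
move=> cA Ax Ay t01.
have := cA x y (Itv01 (andP t01).1 (andP t01).2) (mem_set Ax) (mem_set Ay).
by rewrite inE.
Qed.

(** Dividing by [s + t] gives a convex combination; if [s + t = 0] both weights vanish and any point
    serves. Subadditivity in [sublinear_shift] rests on this. *)
Lemma convex_set_cone {R : realType} {V : lmodType R} {A : set V} {x y : V}
    {s t : R} : convex_set (A : set (convex_lmodType V)) ->
  A x -> A y -> 0 <= s -> 0 <= t ->
  exists2 z, A z & s *: x + t *: y = (s + t) *: z.
Proof.
move=> cA Ax Ay s0 t0; have [st0|st0] := eqVneq (s + t) 0.
  exists x => //; have [-> ->] : s = 0 /\ t = 0 by lra.
  by rewrite !scale0r !addr0 scale0r.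
have stp : 0 < s + t by rewrite lt_def st0 addr_ge0.
exists ((s / (s + t)) *: x + (1 - s / (s + t)) *: y).
  apply: convex_set_conv => //; rewrite divr_ge0 ?addr_ge0//=.
  by rewrite ler_pdivrMr// mul1r lerDl.
by rewrite scalerDr !scalerA; congr (_ *: _ + _ *: _); field.
Qed.

(** * Sublinear functionals and the Hahn-Banach theorem *)

Section Sublinear.
Context {R : realType} {V : lmodType R}.
Implicit Types p q : V -> R.

(** The one-sided bound suffices: used for [t] and [t^-1] it gives positive homogeneity, and at
    [t = 0], with subadditivity, [p 0 = 0]. *)
Definition sublinear p :=
  (forall x y, p (x + y) <= p x + p y) /\
  (forall (t : R) x, 0 <= t -> p (t *: x) <= t * p x).

Lemma sublinear_geN {p} x : sublinear p -> - p (- x) <= p x.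
Proof.
move=> [pD pZ]; have := pD 0 0; have := pD x (- x).
by rewrite subrr addr0; lra.
Qed.

(* The functional is [q z = inf_(t >= 0, x in K) (p (z + t x) - t d)]. *)
Lemma sublinear_shift {p} {K : set V} {d : R} : sublinear p ->
  K !=set0 -> convex_set (K : set (convex_lmodType V)) ->
  (forall x, K x -> d <= p x) ->
  exists q, [/\ sublinear q, forall x, q x <= p x &
                forall x, K x -> q (- x) <= - d].
Proof.
move=> sp [x0 Kx0] cK dp; have [pD pZ] := sp.
pose S z := [set r | exists2 t : R, 0 <= t & exists2 x, K x &
                       r = p (z + t *: x) - t * d].
have S0 z : S z !=set0 by exists (p (z + 0 *: x0) - 0 * d), 0 => //; exists x0.
(* Since [t d <= p (t x)] on [K], subadditivity keeps [p (z + t x) - t d] above [- p (- z)], so the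
   infimum is finite. *)
have lbS z : lbound (S z) (- p (- z)).
  move=> _ [t t0 [x Kx ->]].
  have ptx : p (t *: x) <= p (z + t *: x) + p (- z).
    by have := pD (z + t *: x) (- z); rewrite addrAC subrr add0r.
  move: t0 ptx; rewrite [0 <= t]le_eqVlt => /predU1P[<-|t0].
    rewrite scale0r; have := pD 0 0; rewrite addr0; lra.
  move=> h1; have : p x <= t^-1 * p (t *: x).
    have := pZ t^-1 (t *: x); rewrite scalerK ?gt_eqF//; apply.
    by rewrite invr_ge0 ltW.
  rewrite ler_pdivlMl// => h2; have := dp _ Kx; nra.
have hS z : has_inf (S z) by split => //; exists (- p (- z)).
have leS z r : S z r -> inf (S z) <= r.
  by move=> Szr; apply: ge_inf => //; exact: (hS z).2.
exists (fun z => inf (S z)); split; first split.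
- move=> x y; rewrite -lerBlDr; apply: lb_le_inf => // _ [s s0 [k Kk ->]].
  rewrite lerBlDr -lerBlDl; apply: lb_le_inf => // _ [t t0 [l Kl ->]].
  rewrite lerBlDl.
  have [m Km stm] := convex_set_cone cK Kk Kl s0 t0.
  apply: (@le_trans _ _ (p (x + y + (s + t) *: m) - (s + t) * d)).
    by apply: leS; exists (s + t); [exact: addr_ge0|exists m].
  by have := pD (x + s *: k) (y + t *: l); rewrite addrACA stm; lra.
- move=> t x; rewrite le_eqVlt => /predU1P[<-|t0].
    rewrite mul0r; apply: leS; exists 0 => //; exists x0 => //.
    rewrite !scale0r addr0 mul0r subr0.
    have := pZ 0 0 (lexx _); have := pD 0 0; rewrite !scale0r addr0; lra.
  rewrite -ler_pdivrMl//; apply: lb_le_inf => // _ [s s0 [k Kk ->]].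
  rewrite ler_pdivrMl//.
  apply: (@le_trans _ _ (p (t *: x + (t * s) *: k) - (t * s) * d)).
    by apply: leS; exists (t * s); [rewrite mulr_ge0// ltW|exists k].
  by have := pZ t (x + s *: k) (ltW t0); rewrite scalerDr scalerA; lra.
- move=> x; apply: leS; exists 0 => //; exists x0 => //.
  by rewrite scale0r addr0 mul0r subr0.
- move=> x Kx; apply: (@le_trans _ _ (p (- x + 1 *: x) - 1 * d)).
    by apply: leS; exists 1 => //; exists x.
  by rewrite scale1r addNr mul1r; have := pZ 0 0 (lexx _); rewrite scale0r; lra.
Qed.

(** Zorn's lemma for the reversed order: a chain is bounded by its pointwise infimum, finite because
    every sublinear [q <= p] satisfies [- p (- x) <= q x]. *)
Lemma minimal_sublinear {p} : sublinear p ->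
  exists m, [/\ sublinear m, forall x, m x <= p x &
    forall q, sublinear q -> (forall x, q x <= m x) -> q = m].
Proof.
move=> sp.
pose T := {q | sublinear q /\ forall x, q x <= p x}.
pose mkT q (sq : sublinear q) (qp : forall x, q x <= p x) : T :=
  exist _ q (conj sq qp).
pose le (q r : T) := `[< forall x, sval r x <= sval q x >].
have geN (q : T) x : - p (- x) <= sval q x.
  case: q => q [sq qp]/=; apply: le_trans (sublinear_geN x sq).
  by rewrite lerN2.
have [|q r s /asboolP qr /asboolP rs||C totC|[m [sm mp]] max_m] := @Zorn T le.
- by move=> q; apply/asboolP.
- by apply/asboolP => x; exact: le_trans (rs x) (qr x).
- move=> [q Pq] [r Pr] /asboolP/= rq /asboolP/= qr; apply: eq_exist => /=.
  by apply/funext => x; apply/le_anti; rewrite rq qr.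
- have [[c Cc]|C0] := pselect (C !=set0); last first.
    by exists (mkT p sp (fun=> lexx _)) => q Cq; case: C0; exists q.
  pose S x := [set sval q x | q in C].
  have S0 x : S x !=set0 by exists (sval c x), c.
  have leS (q : T) x : C q -> inf (S x) <= sval q x.
    move=> Cq; apply: ge_inf; last by exists q.
    by exists (- p (- x)) => _ [r _ <-]; exact: geN.
  have sS : sublinear (fun x => inf (S x)).
    split=> [x y|t x].
      rewrite -lerBlDr; apply: lb_le_inf => // _ [q Cq <-].
      rewrite lerBlDr -lerBlDl; apply: lb_le_inf => // _ [r Cr <-].
      rewrite lerBlDl; have [/asboolP qr|/asboolP rq] := totC _ _ Cq Cr.
        apply: le_trans (leS _ _ Cr) _; apply: le_trans ((svalP r).1.1 _ _) _.
        by rewrite lerD2r.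
      apply: le_trans (leS _ _ Cq) _; apply: le_trans ((svalP q).1.1 _ _) _.
      by rewrite lerD2l.
    rewrite le_eqVlt => /predU1P[<-|t0].
      rewrite mul0r; apply: le_trans (leS c _ Cc) _.
      by apply: le_trans ((svalP c).1.2 _ _ _) _ => //; rewrite mul0r.
    rewrite -ler_pdivrMl//; apply: lb_le_inf => // _ [q Cq <-].
    rewrite ler_pdivrMl//; apply: le_trans (leS q _ Cq) _.
    by apply: (svalP q).1.2; exact: ltW.
  have Sp x : inf (S x) <= p x.
    by apply: le_trans (leS _ _ Cc) _; exact: (svalP c).2.
  by exists (mkT _ sS Sp) => q Cq; apply/asboolP => x; exact: leS.
exists m; split => // q sq qm.
have qp x : q x <= p x by exact: le_trans (qm x) (mp x).
have := max_m (mkT q sq qp); rewrite /le/= => /(_ (asboolT qm)).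
by move=> [].
Qed.

(** Shifting by the singleton [[set y]] with [d = m y] yields some [q <= m], which minimality
    identifies with [m]; its bound at [- y] reads [m (- y) <= - m y], whence additivity. *)
Lemma minimal_sublinear_linear {m} : sublinear m ->
  (forall q, sublinear q -> (forall x, q x <= m x) -> q = m) ->
  linear (m : V -> R^o).
Proof.
move=> sm min_m; have [mD mZ] := sm.
have m_add x y : m (x + y) = m x + m y.
  apply/le_anti; rewrite mD/=.
  have cy : convex_set ([set y] : set (convex_lmodType V)).
    move=> a b t; rewrite !inE => -> ->; exact: (@convmm R (convex_lmodType V)).
  have y0 : [set y] !=set0 by exists y.
  have my z : [set y] z -> m y <= m z by move=> ->.
  have [q [sq qm /(_ y erefl)]] := sublinear_shift sm y0 cy my.
  rewrite (min_m q)// => mNy.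
  by have := mD (x + y) (- y); rewrite addrK; lra.
have m0 : m 0 = 0 by have := m_add 0 0; rewrite addr0; lra.
have mN x : m (- x) = - m x by have := m_add x (- x); rewrite subrr m0; lra.
have m_scale t x : 0 <= t -> m (t *: x) = t * m x.
  move=> t0; apply/le_anti; rewrite mZ//=.
  by have := mZ t (- x) t0; rewrite scalerN !mN; lra.
move=> a x y; rewrite m_add; congr (_ + _).
have [a0|a0] := leP 0 a; first exact: m_scale.
have := m_scale (- a) x; rewrite scaleNr mN oppr_ge0 => /(_ (ltW a0)).
by rewrite /GRing.scale/=; lra.
Qed.

(* Mazur-Orlicz form of the Hahn-Banach theorem. *)
Lemma hahn_banach_convex {p} {K : set V} {d : R} : sublinear p ->
  K !=set0 -> convex_set (K : set (convex_lmodType V)) ->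
  (forall x, K x -> d <= p x) ->
  exists f : V -> R^o, [/\ linear f, forall x, f x <= p x &
                           forall x, K x -> d <= f x].
Proof.
move=> sp K0 cK dp.
have [q [sq qp qK]] := sublinear_shift sp K0 cK dp.
have [m [sm mq /(minimal_sublinear_linear sm) lm]] := minimal_sublinear sq.
exists m; split => // [x|x Kx]; first exact: le_trans (mq x) (qp x).
(* Linearity turns [m (- x) <= q (- x) <= - d] into [d <= m x]. *)
have m0 : m 0 = 0.
  by apply: (addrI (m 0)); have := lm 1 0 0; rewrite !scale1r !addr0 => <-.
have := lm (-1) x 0; rewrite !scaleN1r !addr0 m0 addr0 => mN.
by have := le_trans (mq _) (qK _ Kx); rewrite mN lerN2.
Qed.

End Sublinear.

(** * Ultrafilters *)

Lemma ultra_fmap {S T : Type} {U : set_system S} (f : S -> T) :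
  UltraFilter U -> UltraFilter (f @ U).
Proof.
move=> UU; split=> [|G GG UG]; first exact: fmap_proper_filter.
apply/seteqP; split=> // A GA.
have [//|UnA] := in_ultra_setVsetC (f @^-1` A) UU.
have /filter_ex[x []//] : G (A `&` ~` A) by apply: filterI => //; exact: UG.
Qed.

(** Otherwise [F] restricted to the complement of [A] is proper and extends to an ultrafilter
    containing both [A] and its complement. This brings ultrafilter limits back to sequences. *)
Lemma filter_ultra {T : Type} {F : set_system T} {A : set T} : Filter F ->
  (forall U, UltraFilter U -> F `<=` U -> U A) -> F A.
Proof.
move=> FF ultraA; apply: contrapT => nFA.
have PF : ProperFilter (within (~` A) F).
  apply: Build_ProperFilter_ex => B FB; apply: contrapT => B0.
  apply: nFA; apply: (@filterS _ F _ _ _ _ FB) => x BA.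
  by apply: contrapT => /BA Bx; apply: B0; exists x.
have [U [UU FU]] := ultraFilterLemma PF.
have UA : U A.
  by apply: ultraA => // B FB; apply: FU; apply: (@filterS _ F _ B) FB => x.
have UnA : U (~` A) by apply: FU; exact: withinT.
by have /filter_ex[x []] : U (A `&` ~` A) by exact: filterI.
Qed.

(** * Dual functionals and weak limits along filters *)

Section WeakLimits.
Context {R : realType} {X : normedModType R}.
Implicit Types (f : X -> R^o) (x y : X).

Lemma linear_packed f : linear f -> exists F : {linear X -> R^o}, f = F.
Proof.
move=> lf; pose F : {linear X -> R^o} :=
  HB.pack f (GRing.isLinear.Build _ _ _ _ _ lf).
by exists F.
Qed.

Lemma dual_norm_ge_unit f x : dual f -> `|x| <= 1 -> `|f x| <= dual_norm f.
Proof.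
move=> [/linear_packed[F ->]] /linear_bounded_continuous/linear_boundedP.
move=> /pinfty_ex_gt0[r r0 rF] x1; apply: ub_le_sup; last by exists x.
exists r => _ [y /= y1 <-]; apply: le_trans (rF y) _.
by rewrite ger_pMr.
Qed.

Lemma dual_norm_ge f x : dual f -> `|f x| <= dual_norm f * `|x|.
Proof.
move=> df; have [F fF] := linear_packed f df.1.
have [->|x0] := eqVneq x 0; first by rewrite fF linear0 !normr0 mulr0.
have nx0 : 0 < `|x| by rewrite normr_gt0.
rewrite -ler_pdivrMr//; have -> : `|f x| / `|x| = `|f (`|x|^-1 *: x)|.
  by rewrite fF linearZ normrZ gtr0_norm ?invr_gt0// mulrC.
by apply: dual_norm_ge_unit => //; rewrite normrZ normfV normr_id mulVf ?gt_eqF.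
Qed.

Lemma le_norm_dual f : linear f -> (forall x, f x <= `|x|) -> dual f.
Proof.
move=> lf fx; split => //.
have [F fF] := linear_packed f lf; rewrite fF in fx *.
apply/linear_bounded_continuous/bounded_funP => r; exists r => x.
apply: le_trans; rewrite ler_norml fx andbT lerNl -linearN.
by rewrite -normrN.
Qed.

(** Mazur-Orlicz for the norm and the translate [K = C - x], whose points have norm at least [d]
    because [C] is closed. *)
Lemma closed_convex_separation {C : set X} {x} : closed C ->
  convex_set (C : set (convex_lmodType X)) -> C !=set0 -> ~ C x ->
  exists f, dual f /\ exists2 d : R, 0 < d & forall y, C y -> f x + d <= f y.
Proof.
move=> clC cC [c Cc] nCx.
have [d d0 dC] : exists2 d : R, 0 < d & forall y, C y -> d <= `|y - x|.
  have : nbhs x (~` C).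
    by apply: open_nbhs_nbhs; split => //; exact: closed_openC.
  move=> /nbhs_normP[d /= d0 xd]; exists d => // y Cy.
  by rewrite leNgt distrC; apply/negP => /(xd y)/=.
have sn : sublinear (fun z : X => `|z|).
  by split=> [y z|t y t0]; [exact: ler_normD|rewrite normrZ ger0_norm].
pose K := [set y - x | y in C].
have K0 : K !=set0 by exists (c - x), c.
have cK : convex_set (K : set (convex_lmodType X)).
  move=> _ _ t /set_mem[y Cy <-] /set_mem[z Cz <-]; apply/mem_set.
  exists (t%:num *: y + (1 - t%:num) *: z).
    by apply: convex_set_conv => //; rewrite ge0 le1.
  rewrite /conv/= !scalerBr addrACA -opprD -scalerDl; congr (_ - _).
  by rewrite addrC subrK scale1r.
have Kd z : K z -> d <= `|z| by move=> [y Cy <-]; exact: dC.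
have [f [lf fn fK]] := hahn_banach_convex sn K0 cK Kd.
exists f; split; first exact: le_norm_dual.
exists d => // y Cy; have [F fF] := linear_packed f lf.
by rewrite -lerBrDl fF -linearB -fF; apply: fK; exists y.
Qed.

Section Filters.
Context {I : Type} {F : set_system I}.
Implicit Types u v : I -> X.

(** An arbitrary filter lets ultrafilters and [\oo] share the same lemmas; at [\oo] this is
    [weak_cvg]. *)
Definition filter_weak_cvg u x :=
  forall f, dual f -> f (u i) @[i --> F] --> f x.

Lemma filter_weak_cvg_cst x : Filter F -> filter_weak_cvg (fun=> x) x.
Proof. by move=> FF f _; exact: cvg_cst. Qed.

Lemma filter_weak_cvgD u v x y : Filter F -> filter_weak_cvg u x ->
  filter_weak_cvg v y -> filter_weak_cvg (fun i => u i + v i) (x + y).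
Proof.
move=> FF ux vy f df; have [G fG] := linear_packed f df.1.
have fD a b : f (a + b) = f a + f b by rewrite fG linearD.
by under eq_fun do rewrite fD; rewrite fD; apply: cvgD; [exact: ux|exact: vy].
Qed.

Lemma filter_weak_cvgB u v x y : Filter F -> filter_weak_cvg u x ->
  filter_weak_cvg v y -> filter_weak_cvg (fun i => u i - v i) (x - y).
Proof.
move=> FF ux vy f df; have [G fG] := linear_packed f df.1.
have fB a b : f (a - b) = f a - f b by rewrite fG linearB.
by under eq_fun do rewrite fB; rewrite fB; apply: cvgB; [exact: ux|exact: vy].
Qed.

Lemma closed_convex_weak_lim {C : set X} {u x} : ProperFilter F -> closed C ->
  convex_set (C : set (convex_lmodType X)) -> filter_weak_cvg u x ->
  F [set i | C (u i)] -> C x.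
Proof.
move=> FF clC cC ux FC; apply: contrapT => nCx.
have C0 : C !=set0 by have [i Ci] := filter_ex FC; exists (u i).
have [f [df [d d0 fC]]] := closed_convex_separation clC cC C0 nCx.
have : f x + d <= f x.
  apply: (cvgr_to_ge (ux f df)).
  by apply: filterS FC => i /fC.
lra.
Qed.

(** Weak lower semicontinuity of the norm: balls are closed and convex. *)
Lemma weak_lim_norm_le {u x} {r : R} : ProperFilter F -> filter_weak_cvg u x ->
  F [set i | `|u i| <= r] -> `|x| <= r.
Proof.
move=> FF ux Fr; apply: (@closed_convex_weak_lim [set y | `|y| <= r] u) => //.
  apply: (@preimage_closed _ _ (fun y : X => `|y|) [set s | s <= r]).
    by move=> y _; exact: norm_continuous.
  exact: closed_le.
move=> y z t; rewrite !inE/= => yr zr; apply: le_trans (ler_normD _ _) _.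
rewrite !normrZ (ger0_norm (ge0 t)) ger0_norm; last by rewrite subr_ge0 le1.
have -> : r = t%:num * r + (1 - t%:num) * r by ring.
by rewrite lerD// ler_wpM2l// subr_ge0 le1.
Qed.

Lemma reflexive_ultra_weak_lim u (C : R) : reflexive_space X -> UltraFilter F ->
  F [set i | `|u i| <= C] -> exists x, filter_weak_cvg u x.
Proof.
move=> reflX UF FC.
have fuC f : dual f -> F [set i | `|f (u i)| <= C * dual_norm f].
  move=> df; apply: filterS FC => i /= uC.
  apply: le_trans (dual_norm_ge _ _ df) _.
  rewrite mulrC ler_wpM2r//; apply: le_trans (dual_norm_ge_unit _ 0 df _) => //.
  by rewrite normr0.
(* Along an ultrafilter the values [f (u i)], eventually in a compact segment, must converge. *)
have limP f : dual f -> f (u i) @[i --> F] --> lim (f (u i) @[i --> F]).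
  move=> df; have UfF : UltraFilter (f (u i) @[i --> F]) by exact: ultra_fmap.
  set M := C * dual_norm f.
  have := @segment_compact R (- M) M; rewrite compact_ultra => /(_ _ UfF)[].
    apply: (@filterS _ F _ _ _ _ (fuC _ df)) => i /=.
    by rewrite in_itv/= -ler_norml.
  by move=> l [_ /= fl]; apply/cvg_ex; exists l.
have [|x xP] := reflX (fun f => lim (f (u i) @[i --> F])).
  split=> [a f g df dg|].
    apply: cvg_lim => //; apply: cvgD; last exact: limP.
    by apply: cvgM; [exact: cvg_cst|exact: limP].
  by exists C => f df; apply: (cvgr_to_le (cvg_norm (limP f df))); exact: fuC.
by exists x => f df; rewrite -xP//; exact: limP.
Qed.

End Filters.

End WeakLimits.

(** * Strict convexity and property (H) *)

Section StrictConvexity.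
Context {R : realType} {X : normedModType R}.
Implicit Types (u v h : X).

(** The triangle inequality forces both norms to be exactly [d], and dividing by [d] reaches the
    unit sphere. For [d <= 0] both vectors vanish. *)
Lemma strictly_convex_eq {u v} {d : R} : strictly_convex_space X ->
  `|u| <= d -> `|v| <= d -> d <= `|2^-1 *: (u + v)| -> u = v.
Proof.
move=> strictX ud vd; rewrite normrZ ger0_norm ?invr_ge0// => duv.
have uv := ler_normD u v.
have [d0|d0] := leP d 0.
  have /eqP : `|u| = 0 by apply/le_anti; rewrite normr_ge0 (le_trans ud).
  have /eqP : `|v| = 0 by apply/le_anti; rewrite normr_ge0 (le_trans vd).
  by rewrite !normr_eq0 => /eqP -> /eqP ->.
have [{}ud {}vd] : `|u| = d /\ `|v| = d by lra.
apply: contrapT => /eqP uv_neq.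
have : `|2^-1 *: (d^-1 *: u + d^-1 *: v)| < 1.
  apply: strictX; rewrite ?normrZ ?gtr0_norm ?invr_gt0// ?ud ?vd ?mulVf ?gt_eqF//.
  by apply: contra uv_neq => /eqP/scalerI-> //; rewrite invr_eq0 gt_eqF.
rewrite -scalerDr scalerA mulrC -scalerA normrZ gtr0_norm ?invr_gt0//.
rewrite ltr_pdivrMl// mulr1 normrZ ger0_norm ?invr_ge0//; lra.
Qed.

(** [h] is the midpoint of [h + u] and [h - u]. *)
Lemma strictly_convex_eq0 {u h} : strictly_convex_space X ->
  `|h + u| <= `|h| -> `|h - u| <= `|h| -> u = 0.
Proof.
move=> strictX hu hNu; have : h + u = h - u.
  apply: strictly_convex_eq hu hNu _ => //.
  rewrite addrACA subrr addr0 -mulr2n -[h *+ 2]scaler_nat scalerA.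
  by rewrite mulVf ?scale1r.
move/addrI => /eqP; rewrite -subr_eq0 opprK -mulr2n -scaler_nat scaler_eq0.
by rewrite pnatr_eq0/= => /eqP.
Qed.

(** Dividing by the norms moves the sequence to the unit sphere, where (H) applies; convergence of
    the norms allows multiplying back. *)
Lemma property_H_norm {w : nat -> X} {h} : property_H X -> h != 0 ->
  weak_cvg w h -> `|w n| @[n --> \oo] --> `|h| -> w n @[n --> \oo] --> h.
Proof.
move=> HX h0 wh nwh; have nh0 : `|h| != 0 by rewrite normr_eq0.
(* Property (H) wants norm one at every index, hence a default value at the finitely many zeros of
   [w]. *)
pose v n := if w n == 0 then `|h|^-1 *: h else `|w n|^-1 *: w n.
have w0 : \forall n \near \oo, w n != 0.
  near=> n; rewrite -normr_gt0; near: n; apply: (cvgr_gt _ nwh).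
  by rewrite normr_gt0.
have v1 n : `|v n| = 1.
  rewrite /v; case: ifPn => [_|wn0]; rewrite normrZ normfV normr_id mulVf//.
  by rewrite normr_eq0.
have nwVh : `|w n|^-1 @[n --> \oo] --> `|h|^-1 by exact: cvgV.
have vw : \forall n \near \oo, `|w n|^-1 *: w n = v n.
  by apply: filterS w0 => n /negPf wn0; rewrite /v wn0.
have vh : v n @[n --> \oo] --> `|h|^-1 *: h.
  apply: HX => //; first by rewrite normrZ normfV normr_id mulVf.
  move=> f df; have [G fG] := linear_packed f df.1.
  have fZ b x : f (b *: x) = b * f x by rewrite fG linearZ.
  have E : {near \oo, (fun n => `|w n|^-1 * f (w n)) =1 f \o v}.
    by apply: filterS vw => n /= <-; rewrite fZ.
  rewrite fZ; apply: cvg_trans (near_eq_cvg E) _.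
  by apply: cvgM => //; exact: wh.
have -> : h = `|h| *: (`|h|^-1 *: h) by rewrite scalerA mulfV ?scale1r.
have E : {near \oo, (fun n => `|w n| *: v n) =1 w}.
  apply: filterS2 w0 vw => n wn0 <-.
  by rewrite scalerA mulfV ?scale1r ?normr_eq0.
by apply: cvg_trans (near_eq_cvg E) _; exact: cvgZ.
Unshelve. all: by end_near. Qed.

Lemma near_extremal_cvg0 {u : nat -> X} {h} {r : nat -> R} :
  reflexive_space X -> strictly_convex_space X -> property_H X ->
  r n @[n --> \oo] --> 0 ->
  (forall n, `|h + u n| <= `|h| + r n) ->
  (forall n, `|h - u n| <= `|h| + r n) ->
  u n @[n --> \oo] --> 0.
Proof.
move=> reflX strictX HX r0 hu hNu.
have hr : `|h| + r n @[n --> \oo] --> `|h|.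
  by rewrite -[X in _ --> X]addr0; apply: cvgD => //; exact: cvg_cst.
(* [property_H_norm] needs a nonzero limit; when [h = 0] the hypotheses bound [|u n|] by [r n]
   directly. *)
have [h0|h0] := eqVneq h 0.
  apply/norm_cvg0P; apply: (@squeeze_cvgr _ _ _ _ (fun=> 0) r) => //;
    last exact: cvg_cst.
  by apply: nearW => n; rewrite normr_ge0; have := hu n; rewrite h0 normr0 !add0r.
have weak_u : weak_cvg u 0.
  (* It suffices to treat each ultrafilter finer than [\oo]: there [u] has a weak limit [x], with
     [h + x] and [h - x] no longer than [h]. *)
  move=> f df; apply/cvgrPdist_lt => e e0; apply: filter_ultra => U UU ooU.
  have ev_le (v : nat -> X) : (forall n, `|v n| <= `|h| + r n) ->
      forall s : R, `|h| < s -> U [set n | `|v n| <= s].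
    move=> hv s hs; apply: ooU.
    by apply: (filterS _ (cvgr_lt _ hr _ hs)) => n /ltW; exact: le_trans.
  have hh1 : `|h| < `|h| + 1 by rewrite ltrDl.
  have Uu : U [set n | `|u n| <= `|h| + 1 + `|h|].
    apply: (@filterS _ U _ _ _ _ (ev_le _ hu _ hh1)) => n /= un.
    by have := ler_normB (h + u n) h; rewrite addrAC subrr add0r; lra.
  have [x ux] := reflexive_ultra_weak_lim _ _ reflX UU Uu.
  have le_h (v : nat -> X) y : filter_weak_cvg (F := U) v y ->
      (forall n, `|v n| <= `|h| + r n) -> `|y| <= `|h|.
    move=> vy hv; apply/ler_addgt0Pr => s s0.
    by apply: (weak_lim_norm_le _ vy); apply: ev_le hv _ _; rewrite ltrDl.
  have x0 : x = 0.
    apply: (strictly_convex_eq0 (h := h) strictX).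
      exact: le_h (filter_weak_cvgD _ _ _ _ _ (filter_weak_cvg_cst h _) ux) hu.
    exact: le_h (filter_weak_cvgB _ _ _ _ _ (filter_weak_cvg_cst h _) ux) hNu.
  have := ux f df; rewrite x0 => /cvgrPdist_lt; exact.
have weak_hu : weak_cvg (fun n => h + u n) h.
  have := filter_weak_cvgD _ _ _ _ _ (filter_weak_cvg_cst (F := \oo) h _) weak_u.
  by rewrite addr0; exact.
have nhu : `|h + u n| @[n --> \oo] --> `|h|.
  apply: (@squeeze_cvgr _ _ _ _ (fun n => `|h| - r n)
    (fun n => `|h| + r n)) => //.
    (* Lower bound: [h + u n] and [h - u n] sum to [2 h], and the latter has norm at most
       [|h| + r n]. *)
    apply: nearW => n; rewrite hu andbT.
    have := ler_normD (h + u n) (h - u n); have := hNu n.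
    rewrite addrACA subrr addr0 -mulr2n normrMn mulr2n; lra.
  by rewrite -[X in _ --> X]subr0; apply: cvgB => //; exact: cvg_cst.
have -> : u = (fun n => h + u n - h).
  by apply/funext => n; rewrite addrAC subrr add0r.
rewrite -(subrr h); apply: cvgB; last exact: cvg_cst.
exact: property_H_norm.
Qed.

End StrictConvexity.

(** [c / (1 - k)] is the fixed point of [t |-> k t + c]; the larger of it and [s 0] stays an upper
    bound by induction. *)
Lemma affine_recurrence_bounded {R : realType} {k c : R} {s : nat -> R} :
  0 < k < 1 -> (forall n, s n.+1 <= k * s n + c) ->
  exists M, forall n, s n <= M.
Proof.
move=> k01 sS; exists (Num.max (s 0) (c / (1 - k))) => n.
set M := Num.max _ _.
have cM : c <= (1 - k) * M.
  by rewrite mulrC -ler_pdivrMr ?subr_gt0 ?le_max ?lexx ?orbT//; lra.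
by elim: n => [|n IH]; [rewrite le_max lexx|have := sS n; nra].
Qed.

(** * Best proximity pairs of a cyclic contraction *)

Section BestProximity.
Context {R : realType} {X : completeNormedModType R} {A B : set X}.

Lemma dist_le {x y : X} : A x -> B y -> dist A B <= `|x - y|.
Proof.
move=> Ax By; apply: ge_inf; last by exists x => //; exists y.
by exists 0 => _ [a _ [b _ <-]].
Qed.

(** The midpoints lie in [A] and [B] by convexity, so the average of the two differences still has
    norm at least [dist A B]. *)
Lemma best_proximity_diff {x y x' y' : X} : strictly_convex_space X ->
  convex_set (A : set (convex_lmodType X)) ->
  convex_set (B : set (convex_lmodType X)) ->
  A x -> B y -> A x' -> B y' ->
  `|x - y| <= dist A B -> `|x' - y'| <= dist A B -> x - y = x' - y'.
Proof.
move=> strictX cA cB Ax By Ax' By' xy xy'.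
apply: (strictly_convex_eq strictX xy xy').
have half : 0 <= (2^-1 : R) <= 1 by lra.
have := dist_le (convex_set_conv cA Ax Ax' half)
  (convex_set_conv cB By By' half).
rewrite (_ : 1 - 2^-1 = 2^-1 :> R); last by lra.
by rewrite -!scalerDr -scalerBr opprD addrACA.
Qed.

Context {T : X -> X} {k : R} (k01 : 0 < k < 1)
  (TA : forall x, A x -> B (T x)) (TB : forall x, B x -> A (T x))
  (Tk : forall x y, A x -> B y ->
     `|T x - T y| <= k * `|x - y| + (1 - k) * dist A B).
Let d := dist A B.

(** Measured as excess over [d], the contraction is purely multiplicative, so it iterates to
    geometric decay. *)
Lemma cyclic_excess {x y} : A x -> B y ->
  `|T x - T y| - d <= k * (`|x - y| - d).
Proof. by move=> Ax By; have := Tk x y Ax By; rewrite -/d; lra. Qed.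

Lemma cyclic_excess_sym {x y} : B x -> A y ->
  `|T x - T y| - d <= k * (`|x - y| - d).
Proof. by move=> Bx Ay; rewrite distrC (distrC x); exact: cyclic_excess. Qed.

(** Two applications return to [A] and [B]; the factor [k ^ 2] is weakened to [k], the excess being
    nonnegative. *)
Lemma cyclic_excess2 {x y} : A x -> B y ->
  `|T (T x) - T (T y)| - d <= k * (`|x - y| - d).
Proof.
move=> Ax By; have /andP[k0 k1] := k01.
apply: le_trans (cyclic_excess_sym (TA x Ax) (TB y By)) _.
rewrite ler_pM2l//; apply: le_trans (cyclic_excess Ax By) _.
by rewrite ler_piMl// ?subr_ge0 ?(ltW k1)//; exact: dist_le.
Qed.

Lemma best_proximity_pair : reflexive_space X -> closed A -> closed B ->
  convex_set (A : set (convex_lmodType X)) ->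
  convex_set (B : set (convex_lmodType X)) -> B !=set0 ->
  exists x y, [/\ A x, B y & `|x - y| = d].
Proof.
move=> reflX clA clB cA cB [b Bb].
(* The even terms [y] of the orbit of [b] lie in [B], the odd terms [x] in [A]. *)
pose y n := iter n (T \o T) b; pose x n := T (y n).
have By n : B (y n) by elim: n => //= n IH; apply/TA/TB.
have Ax n : A (x n) by exact: TB.
pose c := `|x 0 - y 0| - d.
have xy n : `|x n - y n| <= d + k ^+ n * c.
  elim: n => [|n IH]; first by rewrite expr0 mul1r /c; lra.
  rewrite exprS -mulrA -lerBlDl.
  apply: le_trans (cyclic_excess2 (Ax n) (By n)) _.
  by have /andP[k0 _] := k01; rewrite ler_pM2l// lerBlDl.
(* Comparing [y n.+1] with [T (T (x 0))] gives an affine recurrence for the distance to [x 0]. *)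
have [M yM] : exists M, forall n, `|y n - x 0| <= M.
  pose e := `|T (T (x 0)) - x 0|.
  apply: (affine_recurrence_bounded (c := (1 - k) * d + e) k01) => n.
  have := cyclic_excess2 (Ax 0) (By n).
  have := ler_distD (T (T (x 0))) (y n.+1) (x 0).
  rewrite /= -/d -/e (distrC (x 0) (y n)) (distrC (T (T (x 0))) (T (T (y n)))).
  lra.
have c0 : 0 <= c by rewrite subr_ge0; exact: dist_le.
have kc0 : d + k ^+ n * c @[n --> \oo] --> d.
  rewrite -[X in _ --> X]addr0; apply: cvgD; first exact: cvg_cst.
  under eq_fun do rewrite mulrC; apply: cvg_geometric.
  by have /andP[? ?] := k01; rewrite gtr0_norm.
have [U [UU ooU]] := ultraFilterLemma (@eventually_filter : ProperFilter \oo).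
have Uy : U [set n | `|y n| <= M + `|x 0|].
  apply: filterE => n /=; have := yM n; have := ler_normD (y n - x 0) (x 0).
  by rewrite subrK; lra.
have Ux : U [set n | `|x n| <= d + c + (M + `|x 0|)].
  apply: filterS Uy => n /= yn; have := xy n.
  have : k ^+ n * c <= c.
    by have /andP[/ltW ? /ltW ?] := k01; rewrite ler_piMl// exprn_ile1.
  by have := ler_normD (x n - y n) (y n); rewrite subrK; lra.
have [x' xx'] := reflexive_ultra_weak_lim _ _ reflX UU Ux.
have [y' yy'] := reflexive_ultra_weak_lim _ _ reflX UU Uy.
have Ax' : A x' by apply: (closed_convex_weak_lim _ clA cA xx'); exact: filterE.
have By' : B y' by apply: (closed_convex_weak_lim _ clB cB yy'); exact: filterE.
exists x', y'; split => //; apply/le_anti; rewrite dist_le// andbT.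
(* The norms of [x n - y n] are eventually below [d + e], and the bound passes to the weak limit. *)
apply/ler_addgt0Pr => e e0.
apply: (weak_lim_norm_le _ (filter_weak_cvgB _ _ _ _ _ xx' yy')).
have de : d < d + e by rewrite ltrDl.
apply: ooU; apply: (filterS _ (cvgr_lt _ kc0 _ de)) => n /ltW.
exact: le_trans.
Qed.

(** * The shifted map and its orbits *)

Section ShiftedMap.
Context {h : X} (strictX : strictly_convex_space X)
  (cA : convex_set (A : set (convex_lmodType X)))
  (cB : convex_set (B : set (convex_lmodType X)))
  (hd : `|h| = d).
Let S b := T b + h.
Let D := [set b | B b /\ A (b - h)].

(** Any [z] in [D] provides the pair [z - h], [z] at distance [d], and all such pairs have the same
    difference. *)
Lemma best_proximity_shift {x y} : A x -> B y -> `|x - y| = d ->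
  forall z, D z -> y - x = h.
Proof.
move=> Ax By xy z [Bz Az].
have := best_proximity_diff strictX cA cB Ax By Az Bz.
rewrite xy addrAC subrr add0r normrN hd => /(_ (lexx _) (lexx _)) xyh.
by rewrite -opprB xyh opprK.
Qed.

(** [T] sends the pair [b - h], [b] to another of zero excess, whose difference is therefore [h]
    again. *)
Lemma shifted_mapE {b} : D b -> S b = T (b - h).
Proof.
move=> Db; have [Bb Ab] := Db.
have bh : `|b - h - b| = d by rewrite addrAC subrr add0r normrN.
have Tbh : `|T b - T (b - h)| = d.
  apply/le_anti; rewrite [d <= _]dist_le ?andbT; [|exact: TB|exact: TA].
  have := cyclic_excess Ab Bb; rewrite bh subrr mulr0 distrC; lra.
have := best_proximity_shift (TB b Bb) (TA _ Ab) Tbh b Db.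
by move=> E; rewrite /S -[X in _ + X]E addrC subrK.
Qed.

Lemma shifted_map_in {b} : D b -> D (S b).
Proof.
move=> Db; split; last by rewrite /S addrK; apply: TB; exact: Db.1.
by rewrite shifted_mapE//; apply: TA; exact: Db.2.
Qed.

Lemma shifted_map_iter_in {b} n : D b -> D (iter n S b).
Proof. by move=> Db; elim: n => //= n; exact: shifted_map_in. Qed.

(** Rewriting only [S c] as [T (c - h)] lets [- h] cancel the shift in [S b]; the sign of [h] flips
    between the two sides. *)
Lemma shifted_excessB {b c} : D b -> D c ->
  `|S b - S c - h| - d <= k * (`|b - c + h| - d).
Proof.
move=> Db Dc; rewrite (shifted_mapE Dc) /S addrAC addrK.
have := cyclic_excess_sym Db.1 Dc.2.
by rewrite opprB addrCA (addrC h).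
Qed.

Lemma shifted_excessD {b c} : D b -> D c ->
  `|S b - S c + h| - d <= k * (`|b - c - h| - d).
Proof.
move=> Db Dc; have := shifted_excessB Dc Db.
have normN (u v w : X) : `|u - v + w| = `|v - u - w|.
  by rewrite -normrN opprD opprB.
by rewrite (normN c b h) (normN (S b) (S c) h).
Qed.

(** Both signs are carried together, since each application of [S] exchanges them. *)
Lemma shifted_excess_iter {b c} {r : R} n : D b -> D c ->
  `|b - c + h| <= d + r -> `|b - c - h| <= d + r ->
  `|iter n S b - iter n S c + h| <= d + k ^+ n * r /\
  `|iter n S b - iter n S c - h| <= d + k ^+ n * r.
Proof.
move=> Db Dc bc1 bc2; elim: n => [|n [IH1 IH2]]; first by rewrite expr0 mul1r.
have Dbn := shifted_map_iter_in n Db; have Dcn := shifted_map_iter_in n Dc.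
have /andP[k0 _] := k01; rewrite exprS -mulrA -!lerBlDl; split.
  apply: le_trans (shifted_excessD Dbn Dcn) _.
  by rewrite ler_pM2l// lerBlDl.
apply: le_trans (shifted_excessB Dbn Dcn) _.
by rewrite ler_pM2l// lerBlDl.
Qed.

Lemma shifted_map_fixed_unique {b c} : D b -> D c ->
  S b = b -> S c = c -> b = c.
Proof.
move=> Db Dc Sb Sc; apply/eqP; rewrite -subr_eq0; apply/eqP.
have := shifted_excessD Db Dc; have := shifted_excessB Db Dc.
rewrite Sb Sc => e1 e2; have /andP[k0 k1] := k01.
(* From [p <= k q <= k ^ 2 p] and [k < 1], no excess can be positive. *)
have le0 (p q : R) : p <= k * q -> q <= k * p -> p <= 0.
  move=> pq qp; have kqp : k * q <= k * (k * p) by rewrite ler_pM2l.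
  rewrite -(pmulr_rle0 _ (_ : 0 < (1 - k) * (1 + k))); first by nra.
  by rewrite mulr_gt0//; lra.
apply: (strictly_convex_eq0 (h := h) strictX).
  by rewrite addrC hd -subr_le0; exact: le0 _ _ e2 e1.
by rewrite -normrN opprB hd -subr_le0; exact: le0 _ _ e1 e2.
Qed.

Lemma shifted_map_iter_bounded {b} : D b ->
  exists M, forall n, `|iter n S b - b| <= M.
Proof.
move=> Db.
(* One [d] is the offset in the excess, the other the cost of removing [h] from [S bn - S b + h]. *)
apply: (affine_recurrence_bounded (c := d + d + `|S b - b|) k01) => n.
have Dn := shifted_map_iter_in n Db; set bn := iter n S b in Dn *.
rewrite iterS -/bn; have := shifted_excessD Dn Db.
have : `|bn - b - h| <= `|bn - b| + d by rewrite -hd ler_normB.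
have : `|S bn - S b| <= `|S bn - S b + h| + d.
  by have := ler_normB (S bn - S b + h) h; rewrite addrK hd.
have := ler_distD (S b) (S bn) b.
by have /andP[k0 _] := k01; nra.
Qed.

Lemma shifted_map_iter_cauchy {b} : reflexive_space X -> property_H X -> D b ->
  cauchy (iter n S b @[n --> \oo]).
Proof.
move=> reflX HX Db; have [M bM] := shifted_map_iter_bounded Db.
apply: cauchy_exP => e /= e0.
suff [N bN] : exists N, forall m, `|iter N S b - iter (N + m) S b| < e.
  exists (iter N S b); exists N => // n /= Nn; rewrite -ball_normE /ball_/=.
  by rewrite -(subnKC Nn); exact: bN.
apply: contrapT => nN.
have /choice[m mP] N : exists m, e <= `|iter N S b - iter (N + m) S b|.
  apply: contrapT => nm; apply: nN; exists N => m; rewrite ltNge.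
  by apply/negP => em; apply: nm; exists m.
(* [u N] is a difference of [N]-fold iterates of points at distance at most [M], so it is extremal
   up to [k ^+ N * M] and tends to 0, against the choice of [m]. *)
pose u N := iter N S b - iter (N + m N) S b.
have uP N : `|u N + h| <= d + k ^+ N * M /\ `|u N - h| <= d + k ^+ N * M.
  have Dm := shifted_map_iter_in (m N) Db.
  have bm : `|b - iter (m N) S b| <= M by rewrite distrC.
  rewrite /u iterD; apply: shifted_excess_iter => //; rewrite -hd.
    by have := ler_normD (b - iter (m N) S b) h; lra.
  by have := ler_normB (b - iter (m N) S b) h; lra.
have kM : k ^+ N * M @[N --> \oo] --> 0.
  under eq_fun do rewrite mulrC; apply: cvg_geometric.
  by have /andP[? ?] := k01; rewrite gtr0_norm.
have hu N : `|h + u N| <= `|h| + k ^+ N * M.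
  by rewrite addrC hd; exact: (uP N).1.
have hNu N : `|h - u N| <= `|h| + k ^+ N * M.
  by rewrite distrC hd; exact: (uP N).2.
have u0 := near_extremal_cvg0 reflX strictX HX kM hu hNu.
have /cvgrPdist_lt/(_ e e0)/filter_ex[N] := u0.
by rewrite sub0r normrN ltNge mP.
Qed.

Lemma shifted_map_iter_cvg {b} : reflexive_space X -> property_H X ->
  closed A -> closed B -> D b ->
  exists l, [/\ D l, S l = l & iter n S b @[n --> \oo] --> l].
Proof.
move=> reflX HX clA clB Db; have Dn n := shifted_map_iter_in n Db.
have /cauchy_cvgP/cvg_ex[l bl] := shifted_map_iter_cauchy reflX HX Db.
have Dl : D l.
  split.
    by apply: (closed_cvg B clB _ l bl); apply: nearW => n; exact: (Dn n).1.
  apply: (closed_cvg A clA _ (l - h) (cvgB bl (cvg_cst h))).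
  by apply: nearW => n; exact: (Dn n).2.
exists l; split => //.
have blS : iter n.+1 S b @[n --> \oo] --> l.
  by rewrite (cvg_shiftS (fun n => iter n S b)).
(* In the limit, the excess inequalities between [l] and [iter n S b] bound both [S l - l + h] and
   [S l - l - h] by [d] in norm, so strict convexity gives [S l = l]. *)
have rhs (v : X) : `|v| = d ->
    d + k * (`|l - iter n S b + v| - d) @[n --> \oo] --> d.
  move=> vd; rewrite -[X in _ --> X]addr0 -[in X in _ --> X](mulr0 k).
  apply: cvgD; first exact: cvg_cst.
  apply: cvgMr; rewrite -(subrr d); apply: cvgB; last exact: cvg_cst.
  rewrite -[X in _ --> X]vd; apply: cvg_norm; rewrite -[X in _ --> X]add0r.
  apply: cvgD; last exact: cvg_cst.
  by rewrite -(subrr l); apply: cvgB => //; exact: cvg_cst.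
have lhs v : `|S l - iter n.+1 S b + v| @[n --> \oo] --> `|S l - l + v|.
  apply: cvg_norm; apply: cvgD; last exact: cvg_cst.
  by apply: cvgB => //; exact: cvg_cst.
have vd : `|- h| = d by rewrite normrN.
have e1 : `|S l - l + h| <= d.
  apply: (ler_cvg_to (lhs h) (rhs _ vd)); apply: nearW => n.
  by rewrite -lerBlDl; exact: shifted_excessD Dl (Dn n).
have e2 : `|S l - l - h| <= d.
  apply: (ler_cvg_to (lhs (- h)) (rhs _ hd)); apply: nearW => n.
  by rewrite -lerBlDl; exact: shifted_excessB Dl (Dn n).
apply/eqP; rewrite -subr_eq0; apply/eqP.
apply: (strictly_convex_eq0 (h := h) strictX); first by rewrite addrC hd.
by rewrite distrC hd.
Qed.

End ShiftedMap.

End BestProximity.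

(** * Existence, uniqueness and convergence of orbits *)

Theorem theorem4p10 (R : realType) (X : completeNormedModType R)
  (A B : set X) (T : X -> X)
  (reflX : reflexive_space X) (strictX : strictly_convex_space X)
  (HX : property_H X)
  (neA : A !=set0) (clA : closed A)
  (cvA : convex_set (A : set (convex_lmodType X)))
  (neB : B !=set0) (clB : closed B)
  (cvB : convex_set (B : set (convex_lmodType X)))
  (cycT : cyclic_contraction A B T) :
  exists b0 : X,
    unique (fun b => B b /\ `|b - T b| = dist A B) b0 /\
    exists (h : X) (B_0 : set X),
      let T' := fun b => T b + h in
      [/\ B_0 `<=` B, B_0 b0,
          (forall b, B_0 b -> B_0 (T' b)),
          b0 = T b0 + h &
          (forall b, B_0 b -> iter n T' b @[n --> \oo] --> b0)].
Proof.
have [TAB TBA [k k01 Tk]] := cycT.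
have TA x : A x -> B (T x) by move=> Ax; apply: TAB; exists x.
have TB x : B x -> A (T x) by move=> Bx; apply: TBA; exists x.
have [x [y [Ax By xy]]] :=
  best_proximity_pair k01 TA TB Tk reflX clA clB cvA cvB neB.
pose h := y - x.
have hd : `|h| = dist A B by rewrite distrC.
pose D := [set b | B b /\ A (b - h)].
have Dy : D y by split => //; rewrite /h opprB addrC subrK.
have [b0 [Db0 Tb0 _]] := shifted_map_iter_cvg k01 TA TB Tk strictX cvA cvB hd
  reflX HX clA clB Dy.
(* The pair [T b], [b] attains the distance, so its difference is [h]: best proximity points in [B]
   are fixed points of the shifted map, and uniqueness carries over. *)
have prox b : B b -> `|b - T b| = dist A B -> D b /\ T b + h = b.
  move=> Bb bTb; have Tbb : b - T b = h.
    apply: (best_proximity_shift strictX cvA cvB hd (TB b Bb) Bb _ _ Dy).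
    by rewrite distrC.
  rewrite -Tbb addrC subrK; split => //; split => //.
  by rewrite -Tbb subKr; exact: TB.
exists b0; split.
  split.
    by split; [exact: Db0.1|rewrite -[X in X - _]Tb0 addrAC subrr add0r].
  move=> b [Bb bTb]; have [Db Tb] := prox b Bb bTb.
  exact: (shifted_map_fixed_unique k01 TA TB Tk strictX cvA cvB hd).
exists h, D; split => // [b []//|b|b Db].
- exact: (shifted_map_in TA TB Tk strictX cvA cvB hd).
have [l [Dl Tl bl]] := shifted_map_iter_cvg k01 TA TB Tk strictX cvA cvB hd
  reflX HX clA clB Db.
by rewrite (shifted_map_fixed_unique k01 TA TB Tk strictX cvA cvB hd
  Db0 Dl Tb0 Tl).
Qed.
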